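(* Let $f\in\mathcal F_{L,w}$, $y\in\mathbb R^n$, $\boldsymbol\varepsilon\in[0,\infty)^n$ and $q\in\mathbb N$. Run Algorithm 1 (given in the context) on this input. Then for every $\ell\in\{1,\dots,n\}$ the $\ell$-th component $P_\ell^{L+1}$ of the returned vector $P^{L+1}$ satisfies $$|\partial_\ell f(x)-\partial_\ell f(y)|\le P_\ell^{L+1}\qquad\text{for all }x\in\mathcal B_{\boldsymbol\varepsilon}(y).$$ Moreover, the computed vectors $Q^{m,k}$ satisfy, for every $k\in\{1,\dots,L\}$ and $m=1,\dots,q$, $$|\mu^{(m)}(z^k(x))-\mu^{(m)}(z^k(y))|\le Q^{m,k}\qquad\text{for all }x\in\mathcal B_{\boldsymbol\varepsilon}(y).$$
   Context: $\mathcal F_{L,w}$ denotes the scalar neural networks $f:\mathbb R^n\to\mathbb R$ with $L\ge 1$ hidden layers of width $w$ and activation $\mu=\tanh$ (applied componentwise): $$z^1(x)=W^1x+b^1,\quad a^1=\mu(z^1),\quad z^k=W^ka^{k-1}+b^k,\quad a^k=\mu(z^k)\ (k=2,\dots,L),\quad f=W^{L+1}a^L+b^{L+1},$$ with $W^1\in\mathbb R^{w\times n}$, $W^k\in\mathbb R^{w\times w}$ ($2\le k\le L$), $W^{L+1}\in\mathbb R^{1\times w}$ and biases of matching dimension. $\mathcal B_{\boldsymbol\varepsilon}(y)=\{x\in\mathbb R^n:|x_j-y_j|\le\varepsilon_j,\ j=1,\dots,n\}$. $\mu^{(j)}$ is the $j$-th derivative of $\mu$, applied componentwise. $\odot$ is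 the Hadamard product, and for $v\in\mathbb R^w$, $M\in\mathbb R^{w\times n}$, $v\odot M$ is the Hadamard product of $v$ with every column of $M$. Absolute values and inequalities of vectors and matrices are componentwise. For each $m\ge1$ a number $N_m\in\mathbb N_0$ is fixed, and for $\rho\in\mathbb R^w$ $$Q^{m,k}(\rho)=\sum_{r=1}^{N_m}\frac{\rho^r}{r!}\odot|\mu^{(m+r)}(z^k(y))|+\rho^{N_m+1}\odot\frac{(m+N_m+1)!}{(N_m+1)!}\,2^{m+N_m+2}\exp\{-2\max(0,|z^k(y)|-\rho)\}$$ (componentwise powers, max, exp). Algorithm 1. Input: $f\in\mathcal F_{L,w}$, $y\in\mathbb R^n$, $\boldsymbol\varepsilon\in[0,\infty)^n$, $q\in\mathbb N$. Set $p_0^1=W^1$ and $P^1=0\in\mathbb R^{w\times n}$. For $k=1,\dots,L$: (i) $\widehat p^k=|p_0^k|+P^k$ and $\rho^k=\widehat p^k\boldsymbol\varepsilon\in\mathbb R^w$; (ii) $Q^{m,k}=Q^{m,k}(\rho^k)$ for $m=1,\dots,q$; (iii) $M_1^k=|\mu'(z^k(y))|+Q^{1,k}$; (iv) $B^k=M_1^k\odot\widehat p^k-|\mu'(z^k(y))\odot p_0^k|$; (v) $P^{k+1}=|W^{k+1}|B^k$; (vi) $p_0^{k+1}=W^{k+1}\left(\mu'(z^k(y))\odot p_0^k\right)$. Return $P^{L+1}$ (a row vector with $n$ entries) and $(Q^{m,k})_{1\le m\le q,\,1\le k\le L}$. *)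

(* Defs.v *)
From HB Require Import structures.
From mathcomp Require Import all_boot all_order all_algebra.
From mathcomp Require Import all_classical all_reals all_analysis.
Import Order.TTheory GRing.Theory Num.Theory.
Import numFieldNormedType.Exports.

Set Implicit Arguments.
Unset Strict Implicit.
Unset Printing Implicit Defensive.

Local Open Scope classical_set_scope.
Local Open Scope ring_scope.

Definition tanh (R : realType) (t : R) : R :=
  (expR t - expR (- t)) / (expR t + expR (- t)).

Definition dtanh (R : realType) (m : nat) : R -> R := derive1n m (@tanh R).

(* The norm [`| _ |] on matrices is the sup norm, hence this definition. *)
Definition absmx (R : realType) (a b : nat) (A : 'M[R]_(a, b)) : 'M[R]_(a, b) :=
  map_mx (fun t : R => `|t|) A.

(* Hadamard product of [v] with every column of [M]; for [b = 1] this is the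
   Hadamard product of two vectors. *)
Definition hadamard (R : realType) (a b : nat) (v : 'cV[R]_a) (M : 'M[R]_(a, b)) :
    'M[R]_(a, b) :=
  \matrix_(i, j) (v i 0 * M i j).

Definition box (R : realType) (n : nat) (eps y : 'cV[R]_n) : set 'cV[R]_n :=
  [set x | forall j, `|x j 0 - y j 0| <= eps j 0].

(* Layers are numbered from 1: only [hidden_weight k] and [hidden_bias k] with
   2 <= k <= L are used, the other values of these functions are irrelevant. *)
Record network (R : realType) (L w n : nat) := Network {
  input_weight : 'M[R]_(w, n);
  input_bias : 'cV[R]_w;
  hidden_weight : nat -> 'M[R]_w;
  hidden_bias : nat -> 'cV[R]_w;
  output_weight : 'rV[R]_w;
  output_bias : R }.

(* The pre-activation z^k(x), for k >= 1; the value at k = 0 is a dummy. *)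
Fixpoint preact (R : realType) (L w n : nat) (f : network R L w n) (k : nat)
    (x : 'cV[R]_n) : 'cV[R]_w :=
  match k with
  | 0 => 0
  | 1 => input_weight f *m x + input_bias f
  | k'.+1 => hidden_weight f k *m map_mx (@tanh R) (preact f k' x)
             + hidden_bias f k
  end.

Definition realize (R : realType) (L w n : nat) (f : network R L w n)
    (x : 'cV[R]_n) : R :=
  (output_weight f *m map_mx (@tanh R) (preact f L x)) 0 0 + output_bias f.

Definition partial_deriv (R : realType) (n : nat) (g : 'cV[R]_n -> R) (l : 'I_n)
    (x : 'cV[R]_n) : R :=
  'D_(delta_mx l 0) g x.

(* Q^{m,k}(rho) as a function of zy = z^k(y). *)
Definition Qvec (R : realType) (w : nat) (N : nat -> nat) (m : nat)
    (zy rho : 'cV[R]_w) : 'cV[R]_w :=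
  \col_i
    (\sum_(1 <= r < (N m).+1)
        (rho i 0 ^+ r / (r`!)%:R) * `|dtanh (m + r) (zy i 0)|
     + rho i 0 ^+ (N m).+1
       * (((m + N m).+1`!)%:R / ((N m).+1`!)%:R * 2 ^+ (m + N m).+2
          * expR (- 2 * Num.max 0 (`|zy i 0| - rho i 0)))).

Section Algorithm.
Variables (R : realType) (L w n : nat) (N : nat -> nat).
Variables (f : network R L w n) (y eps : 'cV[R]_n).

Definition step_phat (p0P : 'M[R]_(w, n) * 'M[R]_(w, n)) : 'M[R]_(w, n) :=
  absmx p0P.1 + p0P.2.

Definition step_Q (k m : nat) (p0P : 'M[R]_(w, n) * 'M[R]_(w, n)) : 'cV[R]_w :=
  Qvec N m (preact f k y) (step_phat p0P *m eps).

Definition step_M1 (k : nat) (p0P : 'M[R]_(w, n) * 'M[R]_(w, n)) : 'cV[R]_w :=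
  absmx (map_mx (@dtanh R 1) (preact f k y)) + step_Q k 1 p0P.

Definition step_Dp0 (k : nat) (p0P : 'M[R]_(w, n) * 'M[R]_(w, n)) :
    'M[R]_(w, n) :=
  hadamard (map_mx (@dtanh R 1) (preact f k y)) p0P.1.

Definition step_B (k : nat) (p0P : 'M[R]_(w, n) * 'M[R]_(w, n)) :
    'M[R]_(w, n) :=
  hadamard (step_M1 k p0P) (step_phat p0P) - absmx (step_Dp0 k p0P).

(* The pair (p_0^k, P^k), for 1 <= k <= L; the value at k = 0 is a dummy. *)
Fixpoint alg_state (k : nat) : 'M[R]_(w, n) * 'M[R]_(w, n) :=
  match k with
  | 0 => (0, 0)
  | 1 => (input_weight f, 0)
  | k'.+1 => let p0P := alg_state k' in
             (hidden_weight f k *m step_Dp0 k' p0P,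
              absmx (hidden_weight f k) *m step_B k' p0P)
  end.

(* Returns P^{L+1} and the family of the Q^{m,k}. Ordinals start at 0, so the
   entry of the family at (i, j) is Q^{i+1,j+1}. *)
Definition algorithm1 (q : nat) : 'rV[R]_n * ('I_q -> 'I_L -> 'cV[R]_w) :=
  (absmx (output_weight f) *m step_B L (alg_state L),
   fun (i : 'I_q) (j : 'I_L) => step_Q j.+1 i.+1 (alg_state j.+1)).

End Algorithm.

(* Main.v *)
Require Import Defs.
From HB Require Import structures.
From mathcomp Require Import all_boot all_order all_algebra.
From mathcomp Require Import all_classical all_reals all_analysis.
From mathcomp Require Import ring lra.
Import Order.TTheory GRing.Theory Num.Theory.
Import numFieldNormedType.Exports.
Local Open Scope classical_set_scope.
Local Open Scope ring_scope.

(** Write [mu] for [tanh], [z^k] for the pre-activations and [J^k(x)] for the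
    Jacobian matrix of [z^k] at [x]. By the chain rule [J^1 = W^1],
    [J^(k+1)(x) = W^(k+1) (mu'(z^k(x)) o J^k(x))] with [o] the Hadamard
    product, and the gradient of the network is given by the same formula with
    the output weights. So the matrix [p_0^k] of the algorithm is [J^k(y)], and
    the theorem follows once the entries of [P^k] are known to bound those of
    [|J^k(x) - J^k(y)|] for every [x] in the box. This goes by induction on
    [k].
    - If [P^k] is such a bound, then [phat^k = |J^k(y)| + P^k] dominates
      [|J^k|] on the box. The box is convex, so the mean value theorem on the
      segment from [y] to [x] gives [|z^k(x) - z^k(y)| <= phat^k eps = rho^k]
      ([preact_enclosed]).
    - Expand [mu^(m)] around [z^k(y)] by Taylor's formula with Lagrange
      remainder ([taylor_lagrange]). The derivatives at [z^k(y)] give the sum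
      in [Q^(m,k)]; the remainder contains [mu^(M)], [M = m + N_m + 1], at
      a point whose absolute value is at least [|z^k(y)| - rho^k], and
      [|mu^(M)(t)| <= M! 2^(M+1) exp(-2|t|)] ([normr_dtanh_le]) bounds it by the
      last term of [Q^(m,k)]. This proves the claim on [Q^(m,k)]
      ([dtanh_enclosed]).
    - With [m = 1], errors of the two factors of [mu'(z^k) o J^k] are combined
      into an error [B^k] of the product ([normr_mulB_le]), and multiplication
      by [W^(k+1)] turns it into the bound [P^(k+1) = |W^(k+1)| B^k].

    The bound on the derivatives of [tanh] comes from the equation
    [mu' = (1 - mu)(1 + mu)]. The [m]-th derivative is a polynomial in [mu]; one
    more derivation turns a monomial [(1 - mu)^a (1 + mu)^b] into two
    monomials of degree [a + b + 1], with coefficients [-a] and [b]. Starting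
    from [mu' = (1 - mu)(1 + mu)], the sum of the absolute values of the
    coefficients thus grows by the factors [2, 3, 4, ...], whence the factorial.
    Since [|mu| <= 1], each factor is at most [2], and after keeping one factor
    [1 - mu] and one factor [1 + mu] the decay follows from
    [1 - mu(t)^2 = 4 / (e^t + e^(-t))^2 <= 4 e^(-2|t|)]. *)

Set Implicit Arguments.
Unset Strict Implicit.
Unset Printing Implicit Defensive.

(** * Derivatives along segments and Taylor's formula *)

Section Derivatives.
Variable R : realType.

(** The derivation rules for sums and products are about functions such as
    [f + g] and [f * g], which do not unify with their pointwise forms; this
    lemma goes from one form to the other. *)
Lemma is_derive_congr (V W : normedModType R) (x v : V) (f g : V -> W) (df dg : W) :
  is_derive x v f df -> f =1 g -> df = dg -> is_derive x v g dg.
Proof. by move=> h /funext <- <-. Qed.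

Lemma is_derive_comp_line (f : R -> R) df (a b t : R) :
  is_derive (a + t * b) 1 f df ->
  is_derive t 1 (fun s => f (a + s * b)) (df * b).
Proof.
move=> dfa.
have da : is_derive t 1 (fun s : R => a + s * b) b.
  apply: (is_derive_congr (is_deriveD (is_derive_cst a t 1)
            (is_deriveM (is_derive_id t 1) (is_derive_cst b t 1)))) => //.
  by rewrite /GRing.scale /= mulr0 !add0r mulr1.
exact: (@is_derive1_comp R f (fun s => a + s * b) t _ _ dfa da).
Qed.

Lemma is_derive_line (a b t : R) : is_derive t (1 : R) (fun s => a + s * b) b.
Proof.
apply: (is_derive_congr (is_derive_comp_line (is_derive_id (a + t * b) (1 : R)))) => //.
by rewrite mul1r.
Qed.

Let is_derive_onem (t : R) : is_derive t (1 : R) (fun s : R => 1 - s) (-1).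
Proof.
apply: (is_derive_congr (is_deriveB (is_derive_cst (1 : R) t (1 : R))
                                    (is_derive_id t (1 : R)))) => //.
by rewrite sub0r.
Qed.

(** The derivative of the [r]-th term is [u_(r+1) - u_r], where
    [u_r = r (1 - t)^(r-1) h_r(t) / r!], so that the sum telescopes. *)
Lemma is_derive_taylor_sum (h : nat -> R -> R) (N : nat) (t : R) :
  (forall r s, is_derive s (1 : R) (h r) (h r.+1 s)) ->
  is_derive t 1 (fun s => \sum_(r < N.+1) (1 - s) ^+ r / r`!%:R * h r s)
    ((1 - t) ^+ N / N`!%:R * h N.+1 t).
Proof.
move=> dh; elim: N => [|N IH].
  apply: (is_derive_congr (dh 0%N t)) => [s|].
    by rewrite big_ord1 expr0 divr1 mul1r.
  by rewrite expr0 divr1 mul1r.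
have d1 := is_derive_onem t.
have := is_deriveD IH (is_deriveM (is_deriveM (is_deriveX N.+1 d1)
  (is_derive_cst (N.+1`!%:R^-1 : R) t (1 : R))) (dh N.+1 t)).
move/is_derive_congr; apply => [s|] /=.
  by rewrite [RHS]big_ord_recr !fctE.
rewrite !fctE /GRing.scale /= mulr0 add0r factS natrM invfM exprS.
have N0 : N`!%:R != 0 :> R by rewrite pnatr_eq0 -lt0n fact_gt0.
have N1 : N.+1%:R != 0 :> R by rewrite pnatr_eq0.
field.
by rewrite N0 nat1r N1.
Qed.

(** Parametrising the segment from [a] to [x] by [[0, 1]] covers both orders of
    [a] and [x], and also [a = x]. On [[0, 1]], Rolle's theorem applies to the
    Taylor sum of centre [t] evaluated at [1], corrected by [K (1 - t)^(N+1)]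
    with [K] chosen so that the values at [0] and [1] agree. *)
Lemma taylor_lagrange (g : nat -> R -> R) (N : nat) (a x : R) :
  (forall r s, is_derive s (1 : R) (g r) (g r.+1 s)) ->
  exists2 th, th \in `]0, 1[%R &
    g 0%N x = \sum_(r < N.+1) (x - a) ^+ r / r`!%:R * g r a
           + (x - a) ^+ N.+1 / N.+1`!%:R * g N.+1 (a + th * (x - a)).
Proof.
move=> dg; pose h r t := (x - a) ^+ r * g r (a + t * (x - a)).
have dh r s : is_derive s (1 : R) (h r) (h r.+1 s).
  apply: (is_derive_congr (is_deriveM (is_derive_cst ((x - a) ^+ r : R) s (1 : R))
     (is_derive_comp_line (dg r (a + s * (x - a)))))) => //.
  by rewrite /GRing.scale /= mulr0 addr0 /h exprS /cst; ring.
(* K is the remainder that has to be identified. *)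
pose K := h 0%N 1 - \sum_(r < N.+1) h r 0 / r`!%:R.
pose Phi s := \sum_(r < N.+1) (1 - s) ^+ r / r`!%:R * h r s + K * (1 - s) ^+ N.+1.
pose dPhi s := (1 - s) ^+ N / N`!%:R * h N.+1 s - K * N.+1%:R * (1 - s) ^+ N.
have dP (s : R) : is_derive s (1 : R) Phi (dPhi s).
  have d1 := is_derive_onem s.
  have := is_deriveD (is_derive_taylor_sum N s dh) (is_deriveZ K (is_deriveX N.+1 d1)).
  move/is_derive_congr; apply => [r|/=]; first by rewrite /Phi !fctE.
  by rewrite /GRing.scale /= /dPhi; ring.
have [| | |c c01 Pc] := @Rolle R Phi 0 1 ltr01.
- by move=> s _; case: (dP s).
- by apply: derivable_within_continuous => s _; case: (dP s).
- rewrite /Phi subr0 subrr expr1n mulr1 exprS mul0r mulr0 addr0.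
  rewrite [RHS]big_ord_recl /= expr0 divr1 mul1r [X in _ = _ + X]big1 ?addr0.
    rewrite [X in X + K](_ : _ = \sum_(r < N.+1) h r 0 / r`!%:R).
      by rewrite /K addrC subrK.
    by apply: eq_bigr => r _; rewrite expr1n mul1r mulrC.
  by move=> r _; rewrite /bump /= add1n exprS !mul0r.
exists c => //.
have c1 : 1 - c != 0 by move: c01; rewrite in_itv /= subr_eq0 => /andP[_ /gt_eqF ->].
have : dPhi c = 0 by case: (dP c) => _ <-; case: Pc.
have -> : dPhi c = (1 - c) ^+ N * (N.+1%:R * (h N.+1 c / N.+1`!%:R - K)).
  have N0 : N`!%:R != 0 :> R by rewrite pnatr_eq0 -lt0n fact_gt0.
  have N1 : N.+1%:R != 0 :> R by rewrite pnatr_eq0.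
  rewrite /dPhi factS natrM; field.
  by rewrite N0 nat1r N1.
move/eqP; rewrite mulf_eq0 expf_eq0 (negbTE c1) andbF /= mulf_eq0 pnatr_eq0 /=.
rewrite subr_eq0 => /eqP hK.
have -> : g 0%N x = h 0%N 1 by rewrite /h expr0 mul1r mul1r subrKC.
have -> : h 0%N 1 = \sum_(r < N.+1) h r 0 / r`!%:R + K by rewrite /K addrC subrK.
rewrite -hK /h; congr (_ + _); last by rewrite mulrAC.
by apply: eq_bigr => r _; rewrite mul0r addr0 mulrAC.
Qed.

End Derivatives.

(** * Exponential decay of the derivatives of tanh *)

Section Tanh.
Variable R : realType.
Implicit Types (t u : R) (p q : {poly R}).

Lemma cosh_gt0 t : 0 < expR t + expR (- t).
Proof. by rewrite addr_gt0 ?expR_gt0. Qed.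

Lemma one_sub_sqr_tanh t : 1 - tanh t ^+ 2 = 4 / (expR t + expR (- t)) ^+ 2.
Proof.
have := cosh_gt0 t; have : expR t * expR (- t) = 1 by rewrite expRN divff ?expR_eq0.
rewrite /tanh; set a := expR t; set b := expR (- t) => ab1 /lt0r_neq0 ab0.
(* 4 ab = (a + b)^2 - (a - b)^2. *)
have -> : 4 = 4 * (a * b) by rewrite ab1 mulr1.
by field.
Qed.

Lemma is_derive_tanh t : is_derive t 1 (@tanh R) (1 - tanh t ^+ 2).
Proof.
have dN : is_derive t 1 (fun s : R => expR (- s)) (- expR (- t)).
  by have := is_derive1_comp (is_derive_expR (- t)) (is_deriveNid t 1); rewrite mulrN1.
have c0 := lt0r_neq0 (cosh_gt0 t).
have dS : is_derive t 1 (fun s : R => expR s + expR (- s)) (expR t - expR (- t)).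
  exact: (is_deriveD (is_derive_expR t) dN).
have dD : is_derive t 1 (fun s : R => expR s - expR (- s)) (expR t + expR (- t)).
  by have := is_deriveB (is_derive_expR t) dN; rewrite opprK.
have dV := @is_deriveV R (fun s => expR s + expR (- s)) _ _ _ c0 dS.
apply: (is_derive_congr (is_deriveM dD dV)) => //.
rewrite /tanh /GRing.scale /=.
set a := expR t in c0 *; set b := expR (- t) in c0 *.
by field.
Qed.

(** The derivation [d/dt] seen on polynomials in [tanh t]: the chain rule with
    [tanh' = (1 - tanh) (1 + tanh)]. *)
Definition tanh_deriv p : {poly R} := p^`() * ((1 - 'X) * (1 + 'X)).

Lemma horner_tanh_deriv p u : (tanh_deriv p).[u] = p^`().[u] * (1 - u ^+ 2).
Proof.
rewrite /tanh_deriv hornerM; congr (_ * _).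
by rewrite hornerM !(hornerD, hornerN, hornerX, hornerC); ring.
Qed.

Lemma dtanh_horner m t : dtanh m t = (iter m tanh_deriv 'X).[tanh t].
Proof.
elim: m t => [|m IH] t; first by rewrite /dtanh derive1n0 hornerX.
rewrite /dtanh derive1nS (_ : derive1n m _ = horner (iter m tanh_deriv 'X) \o @tanh R);
  last by apply/funext => s; exact: IH.
rewrite derive1E; have dt := is_derive_tanh t.
by rewrite derive_val /= horner_tanh_deriv.
Qed.

Lemma is_derive_dtanh m t : is_derive t 1 (@dtanh R m) (dtanh m.+1 t).
Proof.
have := is_derive1_comp (is_derive_poly (iter m tanh_deriv 'X) (tanh t))
  (is_derive_tanh t).
move/is_derive_congr; apply => [s /=|]; first by rewrite dtanh_horner.
by rewrite dtanh_horner /= horner_tanh_deriv.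
Qed.

Lemma tanh_deriv_linear c d p q :
  tanh_deriv (c *: p + d *: q) = c *: tanh_deriv p + d *: tanh_deriv q.
Proof. by rewrite /tanh_deriv derivD !derivZ mulrDl -!scalerAl. Qed.

Lemma iter_tanh_deriv_linear m c d p q :
  iter m tanh_deriv (c *: p + d *: q)
    = c *: iter m tanh_deriv p + d *: iter m tanh_deriv q.
Proof. by elim: m => //= m ->; exact: tanh_deriv_linear. Qed.

Lemma tanh_deriv_monomial a b :
  tanh_deriv ((1 - 'X) ^+ a.+1 * (1 + 'X) ^+ b.+1) =
  - a.+1%:R *: ((1 - 'X) ^+ a.+1 * (1 + 'X) ^+ b.+2)
  + b.+1%:R *: ((1 - 'X) ^+ a.+2 * (1 + 'X) ^+ b.+1).
Proof.
have dB : (1 - 'X)^`() = -1 :> {poly R} by rewrite derivB derivX -polyC1 derivC sub0r.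
have dD : (1 + 'X)^`() = 1 :> {poly R} by rewrite derivD derivX -polyC1 derivC add0r.
rewrite /tanh_deriv derivM !deriv_exp dB dD /= -!mul_polyC polyCN !polyC_natr.
rewrite !exprS. ring.
Qed.

(** Each application of [tanh_deriv] raises the degree [a + b + 2] by one and
    multiplies the sum of the absolute values of the coefficients by the degree,
    which gives the falling factorial. Of the factors [1 - u] and [1 + u] of
    a monomial, one of each is kept and the others are bounded by [2]. *)
Lemma normr_iter_tanh_deriv_monomial m a b u : `|u| <= 1 ->
  `|(iter m tanh_deriv ((1 - 'X) ^+ a.+1 * (1 + 'X) ^+ b.+1)).[u]|
    <= 2 ^+ (a + b + m) * ((a + b + m).+1 ^_ m)%:R * (1 - u ^+ 2).
Proof.
move=> u1; have /andP[uge ule] : -1 <= u <= 1 by rewrite -ler_norml.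
elim: m a b => [|m IH] a b.
  rewrite /= ffactn0 mulr1 addn0 !hornerM !horner_exp.
  rewrite !(hornerD, hornerN, hornerX, hornerC) exprD.
  have d0 : 0 <= 1 - u by lra.
  have s0 : 0 <= 1 + u by lra.
  rewrite ger0_norm; last by rewrite mulr_ge0 ?exprn_ge0.
  rewrite [in leRHS](_ : 1 - u ^+ 2 = (1 - u) * (1 + u)); last by ring.
  rewrite !exprSr mulrACA ler_wpM2r ?mulr_ge0//.
  by rewrite ler_pM ?exprn_ge0// lerXn2r ?nnegrE//; lra.
rewrite iterSr tanh_deriv_monomial iter_tanh_deriv_linear hornerD !hornerZ.
apply: (le_trans (ler_normD _ _)).
rewrite !normrM normrN !normr_nat.
apply: (le_trans (lerD (ler_wpM2l (ler0n _ _) (IH a b.+1))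
                       (ler_wpM2l (ler0n _ _) (IH a.+1 b)))).
rewrite !addSn !addnS !addSn -mulrDl -natrD -addnS -!addSnnS ffactnSr.
rewrite (_ : _ - m = a.+1 + b.+1)%N; last first.
  by rewrite -addSn addnK !addSn addnS.
by rewrite natrM !addSn !addnS; lra.
Qed.

Lemma one_sub_sqr_tanh_ge0 t : 0 <= 1 - tanh t ^+ 2.
Proof. by rewrite one_sub_sqr_tanh divr_ge0 ?sqr_ge0. Qed.

Lemma one_sub_sqr_tanh_le t : 1 - tanh t ^+ 2 <= 4 * expR (- 2 * `|t|).
Proof.
rewrite one_sub_sqr_tanh ler_pM2l ?ltr0n//.
have -> : expR (- 2 * `|t|) = (expR `|t| ^+ 2)^-1 by rewrite mulNr expRN (expRM_natl 2).
rewrite lef_pV2 ?posrE ?exprn_gt0 ?cosh_gt0 ?expR_gt0//.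
rewrite lerXn2r ?nnegrE ?expR_ge0 ?(ltW (cosh_gt0 t))//.
by case: (ger0P t) => _; rewrite ?lerDl ?lerDr expR_ge0.
Qed.

Lemma normr_tanh_le1 t : `|tanh t| <= 1.
Proof.
rewrite -(@expr_le1 _ 2)// real_normK ?num_real// -subr_ge0.
exact: one_sub_sqr_tanh_ge0.
Qed.

(** The first derivative is the monomial with [a = b = 0] in
    [normr_iter_tanh_deriv_monomial], and [1 - tanh ^+ 2] is at most
    [4 exp(-2|t|)]. *)
Lemma normr_dtanh_le m t : (0 < m)%N ->
  `|dtanh m t| <= m`!%:R * 2 ^+ m.+1 * expR (- 2 * `|t|).
Proof.
case: m => // m _; rewrite dtanh_horner iterSr.
have -> : tanh_deriv 'X = (1 - 'X) ^+ 1 * (1 + 'X) ^+ 1.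
  by rewrite /tanh_deriv derivX mul1r !expr1.
apply: (le_trans (normr_iter_tanh_deriv_monomial m 0 0 (normr_tanh_le1 t))).
rewrite add0n (_ : m.+1 ^_ m = m.+1`!)%N; last first.
  by rewrite -ffactnn ffactnSr subSnn muln1.
apply: (le_trans (ler_wpM2l _ (one_sub_sqr_tanh_le t))).
  by rewrite mulr_ge0 ?exprn_ge0 ?ler0n.
by rewrite !exprS; lra.
Qed.

End Tanh.

(** * Variation of the derivatives of tanh *)

Section ActivationEnclosure.
Variable R : realType.

(** Taylor's formula for [dtanh m] at [zy]: the intermediate point [c] of the
    remainder satisfies [|c| >= |zy| - rho], where [normr_dtanh_le] applies. *)
Lemma normr_dtanhB_le (m N : nat) (zy zx rho : R) : (0 < m)%N ->
  `|zx - zy| <= rho ->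
  `|dtanh m zx - dtanh m zy| <=
    \sum_(1 <= r < N.+1) (rho ^+ r / (r`!)%:R) * `|dtanh (m + r) zy|
    + rho ^+ N.+1 * (((m + N).+1`!)%:R / (N.+1`!)%:R * 2 ^+ (m + N).+2
                     * expR (- 2 * Num.max 0 (`|zy| - rho))).
Proof.
move=> m0 zxy.
have rho0 : 0 <= rho := le_trans (normr_ge0 _) zxy.
have dg (r : nat) (s : R) : is_derive s (1 : R) (@dtanh R (m + r)) (dtanh (m + r.+1) s).
  by rewrite addnS; exact: is_derive_dtanh.
have [th] := @taylor_lagrange R (fun r => @dtanh R (m + r)) N zy zx dg.
rewrite in_itv /= => /andP[th0 th1]; rewrite addn0 => ->.
set c := zy + _.
rewrite big_ord_recl /= expr0 divr1 mul1r addn0.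
rewrite -[X in `|X - _|]addrA [X in `|X|]addrAC subrr add0r.
apply: (le_trans (ler_normD _ _)); apply: lerD.
  rewrite big_add1 big_mkord.
  apply: (le_trans (ler_norm_sum _ _ _)); apply: ler_sum => r _.
  rewrite /bump /= add1n normrM ler_wpM2r// normrM normrX.
  rewrite normfV normr_nat ler_wpM2r ?invr_ge0 ?ler0n//.
  by rewrite lerXn2r ?nnegrE.
rewrite normrM normrM normrX normfV normr_nat.
have czy : `|zy| - rho <= `|c|.
  have : `|zy - c| <= rho.
    rewrite /c opprD addrA subrr add0r normrN normrM (gtr0_norm th0).
    by apply: le_trans zxy; rewrite ler_piMl// ltW.
  by have := ler_dist_dist zy c; have := ler_norm (`|zy| - `|c|); lra.
have cmax : Num.max 0 (`|zy| - rho) <= `|c| by rewrite ge_max normr_ge0.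
apply: (@le_trans _ _ (rho ^+ N.+1 / N.+1`!%:R *
   ((m + N).+1`!%:R * 2 ^+ (m + N).+2 * expR (- 2 * Num.max 0 (`|zy| - rho))))).
  apply: ler_pM => //.
    by rewrite ler_wpM2r ?invr_ge0 ?ler0n// lerXn2r ?nnegrE.
  rewrite -addnS; apply: le_trans (normr_dtanh_le c _) _; first by rewrite addnS.
  rewrite -addnS ler_wpM2l ?mulr_ge0 ?exprn_ge0 ?ler0n//.
  by rewrite ler_expR; lra.
by lra.
Qed.

End ActivationEnclosure.

(** * Jacobian matrices of the pre-activations *)

Section Differentiation.
Variable R : realType.

(** A directional derivative is the derivative of a function of one real
    variable, to which the one-dimensional chain rule applies. *)
Lemma derive_along_line n (g : 'cV[R]_n -> R) (x v : 'cV[R]_n) :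
  'D_v g x = 'D_1 (fun t : R => g (x + t *: v)) 0.
Proof.
rewrite /derive; congr (lim (_ @ 0^')); apply/funext => h /=.
by rewrite !addr0 scale0r addr0 [h *: v + x]addrC [_%:A]mulr1.
Qed.

Lemma hadamard_mulmx a b c (u : 'cV[R]_a) (M : 'M[R]_(a, b)) (v : 'M[R]_(b, c)) :
  hadamard u M *m v = hadamard u (M *m v).
Proof.
apply/matrixP => i j; rewrite !mxE mulr_sumr; apply: eq_bigr => k _.
by rewrite mxE mulrA.
Qed.

(** Chain rule for one layer along a curve [z]; it serves for the hidden layers
    and, with a single row, for the output layer. *)
Lemma is_derive_layer w p (W : 'M[R]_(p, w)) (c : R) (z : R -> 'cV[R]_w)
    (dz : 'cV[R]_w) (t : R) (i : 'I_p) :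
  (forall j, is_derive t (1 : R) (fun s => z s j 0) (dz j 0)) ->
  is_derive t (1 : R) (fun s => (W *m map_mx (@tanh R) (z s)) i 0 + c)
    ((W *m hadamard (map_mx (@dtanh R 1) (z t)) dz) i 0).
Proof.
move=> dz_t.
have dterm j : is_derive t (1 : R) (fun s => W i j * tanh (z s j 0))
    (W i j * (dtanh 1 (z t j 0) * dz j 0)).
  have dj := @is_derive1_comp R (@tanh R) (fun s => z s j 0) t _ _
    (is_derive_dtanh 0 (z t j 0)) (dz_t j).
  exact: (is_derive_congr (is_deriveZ (W i j) dj)).
apply: (is_derive_congr (is_deriveD (is_derive_sum dterm)
  (is_derive_cst (c : R) t (1 : R)))).
  move=> s; rewrite fctE fct_sumE mxE; congr (_ + _).
  by apply: eq_bigr => j _; rewrite mxE.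
by rewrite addr0 mxE; apply: eq_bigr => j _; rewrite !mxE.
Qed.

End Differentiation.

Section Network.
Variables (R : realType) (L w n : nat) (f : network R L w n).

(** The Jacobian matrix of [preact f k] at [x], by the recursion of the chain
    rule; it is written in the same shape as the recursion for [p_0^k]. *)
Fixpoint jac (k : nat) (x : 'cV[R]_n) : 'M[R]_(w, n) :=
  match k with
  | 0 => 0
  | 1 => input_weight f
  | k'.+1 => hidden_weight f k
             *m hadamard (map_mx (@dtanh R 1) (preact f k' x)) (jac k' x)
  end.

Lemma is_derive_preact k (x v : 'cV[R]_n) (i : 'I_w) (t : R) :
  is_derive t (1 : R) (fun s => preact f k (x + s *: v) i 0)
    ((jac k (x + t *: v) *m v) i 0).
Proof.
elim: k i => [|[|k] IH] i.
- by apply: (is_derive_congr (is_derive_cst (0 : R) t (1 : R))) => [s|];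
    rewrite ?mul0mx mxE.
- apply: (is_derive_congr (is_derive_line (preact f 1 x i 0)
    ((input_weight f *m v) i 0) t)) => // s.
  by rewrite /= mulmxDr -scalemxAr !mxE addrAC.
- rewrite /= -mulmxA hadamard_mulmx.
  apply: (is_derive_congr (is_derive_layer (hidden_weight f k.+2)
    (hidden_bias f k.+2 i 0) i IH)) => // s.
  by rewrite [RHS]mxE.
Qed.

Lemma partial_deriv_realize l (x : 'cV[R]_n) :
  partial_deriv (realize f) l x =
  (output_weight f *m hadamard (map_mx (@dtanh R 1) (preact f L x)) (jac L x)) 0 l.
Proof.
rewrite /partial_deriv derive_along_line.
have dr := is_derive_layer (output_weight f) (output_bias f) 0
  (fun j => is_derive_preact L x (delta_mx l 0) j 0).
case: dr => _ ->; rewrite scale0r addr0 -hadamard_mulmx mulmxA.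
by rewrite -colE mxE.
Qed.

Lemma preact_mean_value k (x y : 'cV[R]_n) (i : 'I_w) :
  exists2 th : R, 0 < th < 1 &
    preact f k x i 0 - preact f k y i 0
      = (jac k (y + th *: (x - y)) *m (x - y)) i 0.
Proof.
have dp t := is_derive_preact k y (x - y) i t.
have [|th th01] := MVT (ltr01 : 0 < 1 :> R) (fun t _ => dp t).
  by apply: derivable_within_continuous => s _; case: (dp s).
rewrite scale1r scale0r addr0 subr0 mulr1 subrKC => ->.
by exists th => //; move: th01; rewrite in_itv.
Qed.

End Network.

(** * Error propagation through the layers *)

Section Enclosure.
Variable R : realType.

(** Expand [a b - a0 b0] in powers of the errors [a - a0] and [b - b0]: the bound
    [Q P + Q |b0| + |a0| P] is the right-hand side. *)
Lemma normr_mulB_le (a a0 b b0 Q P : R) : `|a - a0| <= Q -> `|b - b0| <= P ->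
  `|a * b - a0 * b0| <= (`|a0| + Q) * (`|b0| + P) - `|a0 * b0|.
Proof.
move=> aQ bP.
have -> : a * b - a0 * b0 = (a - a0) * (b - b0) + (a - a0) * b0 + a0 * (b - b0) by ring.
apply: (@le_trans _ _ (Q * P + Q * `|b0| + `|a0| * P)); last by rewrite normrM; lra.
apply: (le_trans (ler_normD _ _)); apply: lerD.
  apply: (le_trans (ler_normD _ _)); rewrite !normrM.
  by apply: lerD; [exact: ler_pM|exact: ler_wpM2r].
by rewrite normrM ler_wpM2l.
Qed.

Lemma normr_mulmxB_le m n p (A : 'M[R]_(m, n)) (B B' C : 'M[R]_(n, p)) i l :
  (forall j, `|B j l - B' j l| <= C j l) ->
  `|(A *m B) i l - (A *m B') i l| <= (absmx A *m C) i l.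
Proof.
move=> BC; rewrite !mxE -sumrB; apply: (le_trans (ler_norm_sum _ _ _)).
by apply: ler_sum => j _; rewrite -mulrBr normrM mxE ler_wpM2l.
Qed.

Lemma box_segment n (eps y x : 'cV[R]_n) (th : R) : 0 <= th <= 1 ->
  box eps y x -> box eps y (y + th *: (x - y)).
Proof.
move=> /andP[th0 th1] xB j; rewrite !mxE addrAC subrr add0r normrM ger0_norm//.
by apply: le_trans (xB j); rewrite ler_piMl.
Qed.

End Enclosure.

Section AlgorithmCorrect.
Variables (R : realType) (L w n : nat) (N : nat -> nat).
Variables (f : network R L w n) (y eps : 'cV[R]_n).

Local Notation state k := (alg_state N f y eps k).

Lemma alg_state_jac k : (state k).1 = jac f k y.
Proof.
elim: k => [|[|k] IH] //.
by rewrite -[LHS]/(_ *m step_Dp0 f y k.+1 (state k.+1)) /step_Dp0 IH.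
Qed.

(** The loop invariant of the algorithm: together with [alg_state_jac], it says
    that the state describes an interval matrix containing [J^k] of the
    box. *)
Definition jac_enclosed k := forall x, box eps y x -> forall i l,
  `|jac f k x i l - jac f k y i l| <= (state k).2 i l.

Lemma normr_jac_le k x i l : jac_enclosed k -> box eps y x ->
  `|jac f k x i l| <= step_phat (state k) i l.
Proof.
move=> Jk xB; rewrite !mxE alg_state_jac.
have := Jk x xB i l; have := ler_normD (jac f k y i l) (jac f k x i l - jac f k y i l).
by rewrite subrKC; lra.
Qed.

(** Mean value theorem on the segment from [y] to [x], which stays in the box. *)
Lemma preact_enclosed k x i : jac_enclosed k -> box eps y x ->
  `|preact f k x i 0 - preact f k y i 0| <= (step_phat (state k) *m eps) i 0.
Proof.
move=> Jk xB; have [th /andP[th0 th1] ->] := preact_mean_value f k x y i.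
rewrite !mxE; apply: (le_trans (ler_norm_sum _ _ _)).
apply: ler_sum => l _; rewrite normrM; apply: ler_pM => //.
  by apply: normr_jac_le => //; apply: box_segment; rewrite // !ltW.
by have := xB l; rewrite !mxE.
Qed.

Lemma dtanh_enclosed k m x i : jac_enclosed k -> (0 < m)%N -> box eps y x ->
  `|dtanh m (preact f k x i 0) - dtanh m (preact f k y i 0)|
    <= step_Q N f y eps k m (state k) i 0.
Proof.
by move=> Jk m0 xB; rewrite mxE; apply: normr_dtanhB_le => //; exact: preact_enclosed.
Qed.

Lemma hadamard_jac_enclosed k x j l : jac_enclosed k -> box eps y x ->
  `|hadamard (map_mx (@dtanh R 1) (preact f k x)) (jac f k x) j l
    - hadamard (map_mx (@dtanh R 1) (preact f k y)) (jac f k y) j l|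
    <= step_B N f y eps k (state k) j l.
Proof.
move=> Jk xB.
have := normr_mulB_le (dtanh_enclosed j Jk (ltn0Sn 0) xB) (Jk x xB j l).
by rewrite /step_B /step_M1 /step_phat /step_Dp0 /absmx alg_state_jac !mxE.
Qed.

(** The invariant at [k] makes [hadamard_jac_enclosed] available, and
    multiplication by the weights carries that bound to [k + 1]. *)
Lemma alg_jac_enclosed k : jac_enclosed k.
Proof.
elim: k => [|[|k] IH] x xB i l.
- by rewrite subrr normr0 mxE.
- by rewrite subrr normr0 mxE.
rewrite -[(state k.+2).2]/(absmx _ *m step_B N f y eps k.+1 (state k.+1)) /=.
by apply: normr_mulmxB_le => j; exact: (hadamard_jac_enclosed j l IH xB).
Qed.

End AlgorithmCorrect.

Theorem theorem3p6 (R : realType) (L w n : nat) (N : nat -> nat)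
    (f : network R L w n) (y eps : 'cV[R]_n) (q : nat)
    (hL : (1 <= L)%N) (hq : (1 <= q)%N) (heps : forall j, 0 <= eps j 0) :
  let: (P, Q) := algorithm1 N f y eps q in
  (forall (l : 'I_n) (x : 'cV[R]_n), box eps y x ->
     `|partial_deriv (realize f) l x - partial_deriv (realize f) l y| <= P 0 l)
  /\
  (forall (k : 'I_L) (m : 'I_q) (x : 'cV[R]_n), box eps y x ->
     forall i : 'I_w,
     `|dtanh m.+1 (preact f k.+1 x i 0) - dtanh m.+1 (preact f k.+1 y i 0)|
       <= Q m k i 0).
Proof.
split=> [l x xB|k m x xB i].
  rewrite !partial_deriv_realize; apply: normr_mulmxB_le => j.
  exact: (hadamard_jac_enclosed j l (@alg_jac_enclosed _ _ _ _ N f y eps L) xB).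
apply: (dtanh_enclosed i (@alg_jac_enclosed _ _ _ _ N f y eps k.+1)) => //.
Qed.
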